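(* Let $(X,\tau,g)$ be a $\Sigma_g$-semicomplete space. Let the set-valued map $T:X\rightrightarrows X$ satisfy $T(x)\neq\varnothing$ for all $x\in X$. Let the function $f:X\to\mathbb{R}\cup\{+\infty\}$ be proper, lower semicontinuous and bounded below. Assume that for any $x\in X$ there exists $y\in T(x)$ such that $$g(y,x)\le f(x)-f(y).$$ Then $T$ has a fixed point, that is, there exists $\bar x\in X$ such that $\bar x\in T(\bar x)$.
   Context: $\mathbb{R}^+=[0,\infty)$. A premetric space $(X,\tau,g)$ is a first countable topological space $(X,\tau)$ with a premetric function $g:X\times X\to\mathbb{R}^+$, i.e. (P1) $g(x,x)=0$ for all $x\in X$ and $g(x,y)>0$ whenever $x\neq y$; (P2) $g(x,\cdot)$ is continuous for every fixed $x\in X$. (No symmetry or triangle inequality is assumed.) A sequence $\{x_n\}_{n\ge0}$ in $X$ is $\Sigma_g$-Cauchy if its $g$-length $\sum_{i=0}^\infty g(x_{i+1},x_i)$ is finite. $(X,\tau,g)$ is called $\Sigma_g$-semicomplete if it is a first countable premetric space in which every $\Sigma_g$-Cauchy sequence has a convergent subsequence. A set-valued map $T:X\rightrightarrows X$ assigns to each $x$ a subset $T(x)\subset X$. Proper means $f$ is not identically $+\infty$. If $f(x)=+\infty$ and $f(y)<+\infty$, then $f(x)-f(y)=+\infty$. *)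

(* Defs.v *)
From HB Require Import structures.
From mathcomp Require Import all_boot all_order all_algebra.
From mathcomp Require Import all_classical all_reals all_analysis.

Set Implicit Arguments.
Unset Strict Implicit.
Unset Printing Implicit Defensive.

Import Order.TTheory GRing.Theory Num.Theory.
Import numFieldNormedType.Exports.

Local Open Scope classical_set_scope.
Local Open Scope ring_scope.

Definition first_countable (X : topologicalType) : Prop :=
  forall x : X, exists B : set (set X),
    [/\ countable B, B `<=` nbhs x
      & forall A, nbhs x A -> exists2 U, B U & U `<=` A].

Definition premetric (R : realType) (X : topologicalType) (g : X -> X -> R) :
    Prop :=
  [/\ forall x y, 0 <= g x y,
      forall x, g x x = 0,
      forall x y, x <> y -> 0 < g x y
    & forall x, continuous (g x)].

Definition premetric_space (R : realType) (X : topologicalType)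
    (g : X -> X -> R) : Prop :=
  first_countable X /\ premetric g.

(* [g] need not be symmetric: the later term of the sequence comes first. *)
Definition g_length (R : realType) (X : topologicalType) (g : X -> X -> R)
    (x : nat -> X) : \bar R :=
  (\sum_(0 <= i <oo) (g (x i.+1) (x i))%:E)%E.

Definition sum_cauchy (R : realType) (X : topologicalType) (g : X -> X -> R)
    (x : nat -> X) : Prop :=
  (g_length g x < +oo)%E.

(* Limits need not be unique, since [X] is not assumed to be Hausdorff. *)
Definition has_convergent_subsequence (X : topologicalType) (x : nat -> X) :
    Prop :=
  exists phi : nat -> nat,
    {homo phi : m n / (m < n)%N} /\
    exists l : X, (fun n => x (phi n)) @ \oo --> l.

Definition sum_semicomplete (R : realType) (X : topologicalType)
    (g : X -> X -> R) : Prop :=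
  premetric_space g /\
  forall x : nat -> X, sum_cauchy g x -> has_convergent_subsequence x.

(* On [\bar R], [+oo - y = +oo] for finite [y], and [+oo - +oo = -oo]: an
   inequality [a%:E <= f x - f y] thus fails when [f x = f y = +oo], where the
   difference is undefined. *)
Definition proper_efun (R : realType) (X : Type) (f : X -> \bar R) : Prop :=
  exists x, f x <> +oo%E.

Definition bounded_below_efun (R : realType) (X : Type) (f : X -> \bar R) : Prop :=
  exists m : R, forall x, (m%:E <= f x)%E.

(* Main.v *)
(* Without a triangle inequality the relation [g y x <= f x - f y] is not
   transitive, so no maximal point is available.  Relax it to the steps
   [g y x <= 2 * (f x - f y)], and from each [x n] take a step which nearly
   minimizes [f].  The sequence has finite length; let [l] be a limit of a
   subsequence, so that [f l <= f (x n)] for all [n].  If [z] is in [T l] and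
   differs from [l], then [0 < g z l <= f l - f z], whence
   [g z l < 2 * (f l - f z)] strictly; by continuity of [g z], a step from [x n]
   to [z] is allowed for infinitely many [n], and near-minimality yields
   [f l <= f z], a contradiction. *)
Require Import Defs.
From HB Require Import structures.
From mathcomp Require Import all_boot all_order all_algebra.
From mathcomp Require Import all_classical all_reals all_analysis.
From mathcomp Require Import lra.

Import Order.TTheory GRing.Theory Num.Theory.
Import numFieldNormedType.Exports.

Local Open Scope classical_set_scope.
Local Open Scope ring_scope.

Lemma leq_homo_ltn (phi : nat -> nat) :
  {homo phi : m n / (m < n)%N} -> forall n, (n <= phi n)%N.
Proof.
by move=> hphi; elim=> [//|n IHn]; apply: leq_ltn_trans IHn (hphi _ _ _).
Qed.

Lemma exists_near_minimizer {R : realType} {X : Type} (A : set X) (F : X -> R)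
    (m e : R) :
  A !=set0 -> (forall x, A x -> m <= F x) -> 0 < e ->
  exists2 y, A y & forall z, A z -> F y <= F z + e.
Proof.
move=> [a Aa] hm e0.
have hinf : has_inf (F @` A).
  by split; [exists (F a), a | exists m => _ [x Ax <-]; exact: hm].
have [_ [y Ay <-] hy] := inf_adherent e0 hinf.
exists y => // z Az; apply: (le_trans (ltW hy)); rewrite lerD2r.
by apply: ge_inf; [exact: hinf.2 | exists z].
Qed.

(** The partial sums telescope below [c * (F (x 0) - F (x n))], and [m] bounds this uniformly in
    [n]. *)
Lemma sum_cauchy_telescope {R : realType} {X : topologicalType}
    (g : X -> X -> R) (F : X -> R) (x : nat -> X) (c m : R) :
  (forall u v, 0 <= g u v) -> 0 <= c -> (forall n, m <= F (x n)) ->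
  (forall n, g (x n.+1) (x n) <= c * (F (x n) - F (x n.+1))) ->
  sum_cauchy g x.
Proof.
move=> g0 c0 hm hstep.
apply: (@le_lt_trans _ _ ((c * (F (x 0%N) - m))%:E)); last exact: ltry.
apply: lime_le; first by apply: is_cvg_nneseries => n _ _; rewrite lee_fin.
apply: nearW => n; rewrite sumEFin lee_fin.
apply: (@le_trans _ _ (c * (F (x 0%N) - F (x n)))); last first.
  by rewrite ler_wpM2l// lerB.
elim: n => [|n IHn]; first by rewrite big_geq// subrr mulr0.
rewrite big_nat_recr//=; have := hstep n; lra.
Qed.

(** Were [f (x n) < f l], then [f] would exceed [f (x n)] on a neighbourhood of [l]. This contains
    some [x (phi k)] with [phi k >= n], against monotonicity. *)
Lemma lsc_cluster_le {R : realType} {X : topologicalType} (f : X -> \bar R)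
    (x : nat -> X) (phi : nat -> nat) (l : X) :
  lower_semicontinuous f -> {homo phi : m n / (m < n)%N} ->
  (fun n => x (phi n)) @ \oo --> l ->
  (forall m n, (m <= n)%N -> (f (x n) <= f (x m))%E) ->
  (forall n, f (x n) \is a fin_num) ->
  forall n, (f l <= f (x n))%E.
Proof.
move=> f_lsc hphi hl fdec ffin n; rewrite leNgt; apply/negP.
rewrite -(fineK (ffin n)) => /(f_lsc l)[V Vl hV].
have [N _ hN] := hl _ Vl.
have /hV := hN (maxn n N) (leq_maxr _ _); rewrite fineK// ltNge fdec//.
exact: leq_trans (leq_maxl n N) (leq_homo_ltn _ hphi _).
Qed.

Section variational_principle.
Context {R : realType} {X : topologicalType}.
Variables (g : X -> X -> R) (f : X -> \bar R) (c : R).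
Hypotheses (g_premetric : premetric g) (c_gt0 : 0 < c).
Hypotheses (f_lsc : lower_semicontinuous f) (f_bounded : bounded_below_efun f).

(** [fine] sends [+oo] to 0, so a step into an infinite value must be excluded explicitly;
    finiteness at the source is carried separately. *)
Definition descent (x y : X) : Prop :=
  f y \is a fin_num /\ g y x <= c * (fine (f x) - fine (f y)).

Lemma descent_le x y : descent x y -> fine (f y) <= fine (f x).
Proof.
move=> [_ hxy]; case: g_premetric => g0 _ _ _.
by rewrite -subr_ge0 -(pmulr_rge0 _ c_gt0) (le_trans (g0 y x)).
Qed.

Lemma greedy_descent x0 : f x0 \is a fin_num ->
  exists x : nat -> X, [/\ forall n, f (x n) \is a fin_num,
    forall n, descent (x n) (x n.+1)
  & forall n z, descent (x n) z ->
      fine (f (x n.+1)) <= fine (f z) + n.+1%:R^-1].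
Proof.
move=> fx0; case: g_premetric => _ gxx _ _; have [m hm] := f_bounded.
(* The index is paired with the point because the tolerance depends on it. Finiteness is a premise
   inside the existential so that [choice] yields a total function. *)
have hnext (p : nat * X) : exists y, f p.2 \is a fin_num -> descent p.2 y /\
    forall z, descent p.2 z -> fine (f y) <= fine (f z) + p.1.+1%:R^-1.
  case: p => n x /=.
  have [fx|fx] := boolP (f x \is a fin_num); last by exists x.
  have [|||y Ay hy] :=
      @exists_near_minimizer R X (descent x) (fine \o f) m n.+1%:R^-1.
  (* Staying put is always an allowed step, since [g x x = 0]. *)
  - by exists x; split=> //; rewrite gxx subrr mulr0.
  - by move=> y [fy _] /=; rewrite -lee_fin fineK.
  - by rewrite invr_gt0 ltr0n.
  by exists y.
have [next hnxt] := choice hnext.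
pose x := fix x n := if n is k.+1 then next (k, x k) else x0.
have fx n : f (x n) \is a fin_num.
  by elim: n => [//|n IHn]; have [[]] := hnxt (n, x n) IHn.
by exists x; split=> // n; have [] := hnxt (n, x n) (fx n).
Qed.

Hypothesis g_semicomplete :
  forall x : nat -> X, sum_cauchy g x -> has_convergent_subsequence x.

(** The final inequality is weak because its negation, being strict, persists for points near
    [l]. *)
Lemma variational_principle x0 : f x0 \is a fin_num ->
  exists2 l, f l \is a fin_num & forall z, f z \is a fin_num ->
    fine (f z) < fine (f l) -> c * (fine (f l) - fine (f z)) <= g z l.
Proof.
move=> /greedy_descent[x [fx xdesc xmin]].
case: g_premetric => g0 _ _ gcont; have [m hm] := f_bounded.
have /g_semicomplete[phi [hphi [l hl]]] : sum_cauchy g x.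
  apply: (@sum_cauchy_telescope _ _ _ (fine \o f) _ c m) => //.
  - exact: ltW.
  - by move=> n /=; rewrite -lee_fin fineK.
  - by move=> n; have [] := xdesc n.
have fdec i j : (i <= j)%N -> (f (x j) <= f (x i))%E.
  move=> /subnK <-; elim: (j - i)%N => [//|k IHk]; apply: le_trans IHk.
  by rewrite addSn -(fineK (fx _)) -[leRHS](fineK (fx _)) lee_fin descent_le.
have fl_le := lsc_cluster_le _ _ _ _ f_lsc hphi hl fdec fx.
have fl : f l \is a fin_num.
  rewrite fin_numElt (lt_le_trans (ltNyr m) (hm l))/=.
  by rewrite (le_lt_trans (fl_le 0%N))// ltey_eq fx.
have Fl_le n : fine (f l) <= fine (f (x n)) by rewrite -lee_fin !fineK.
exists l => // z fz fzl; rewrite leNgt; apply/negP => hz.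
have /hl[N _ hN] : nbhs l [set u | g z u < c * (fine (f l) - fine (f z))].
  exact: (gcont z l) (lt_nbhsl hz).
have dlz : 0 < fine (f l) - fine (f z) by rewrite subr_gt0.
have [K hK] : exists K : nat, K.+1%:R^-1 < fine (f l) - fine (f z).
  have [K _ hK] := near_infty_natSinv_lt (PosNum dlz).
  by exists K; apply: (hK K) => /=.
(* [N] puts [x (phi k)] in the neighbourhood of [l]; [K] makes the tolerance at index [phi k >= k]
   smaller than the gap between [f l] and [f z]. *)
pose k := maxn N K.
have desc_z : descent (x (phi k)) z.
  split=> //; apply: (le_trans (ltW (hN k (leq_maxl _ _)))).
  (* Replacing [f l] by the larger [f (x (phi k))] only weakens the bound. *)
  by rewrite ler_pM2l// lerB.
suff : fine (f l) <= fine (f z) + K.+1%:R^-1.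
  by rewrite -lerBlDl leNgt hK.
apply: (le_trans (Fl_le (phi k).+1)); apply: (le_trans (xmin _ _ desc_z)).
rewrite lerD2l lef_pV2 ?posrE ?ltr0n// ler_nat ltnS.
exact: leq_trans (leq_maxr N K) (leq_homo_ltn _ hphi _).
Qed.

End variational_principle.

Theorem theorem3p5 (R : realType) (X : topologicalType) (g : X -> X -> R)
    (hX : sum_semicomplete g)
    (T : X -> set X) (hT : forall x, T x !=set0)
    (f : X -> \bar R) (f_codomain : forall x, f x <> -oo%E)
    (f_proper : proper_efun f) (f_lsc : lower_semicontinuous f)
    (f_bounded : bounded_below_efun f)
    (hfT : forall x, exists y, T x y /\ ((g y x)%:E <= f x - f y)%E) :
  exists xbar : X, T xbar xbar.
Proof.
have [[_ gP] gsc] := hX; have [x0 /eqP fx0] := f_proper.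
have fx0_fin : f x0 \is a fin_num.
  by rewrite fin_numE fx0 andbT; apply/eqP.
have [l fl hl] :=
  @variational_principle _ _ g f 2 gP (ltr0Sn _ _) f_lsc f_bounded gsc x0 fx0_fin.
have [z [Tz gz]] := hfT l.
exists l; have [zl|zl] := pselect (z = l); first by rewrite -{2}zl.
have fz : f z \is a fin_num.
  rewrite fin_numE; apply/andP; split; first exact/eqP.
  (* If [f z = +oo], the difference is [-oo], which bounds no real from above. *)
  by apply/eqP => fzy; move: gz; rewrite fzy -(fineK fl).
move: gz; rewrite -(fineK fl) -(fineK fz) lee_fin => gz.
case: gP => _ _ /(_ z l zl) gzl _.
have flz : fine (f z) < fine (f l) by lra.
(* With [d = f l - f z > 0], this gives [2 * d <= g z l <= d], which is absurd; any constant above 1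
   would serve. *)
have := hl z fz flz; lra.
Qed.
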